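(* Let $n\ge 4$ be an integer, let $x$ be an integer with $2\le x\le n-2$ and $x\equiv n\pmod 2$, and let $k$ be an integer with $\left\lfloor\frac{n}{n-x+1}\right\rfloor\le k\le\left\lfloor\frac{x}{2}\right\rfloor$. Then $$\hat F_n(x,k)=\begin{cases}\displaystyle\sum_{i=0}^{\lfloor\frac{k-2}{2}\rfloor}F_{\lfloor\frac n2\rfloor-i-1}\!\left(\left\lfloor\tfrac x2\right\rfloor-i,k\right)+\sum_{j=0}^{k}F_{\frac{n-k}{2}-1}\!\left(\tfrac{x-k}{2},j\right) & \text{if } k+n \text{ is even},\\[4pt] \displaystyle\sum_{i=0}^{\lfloor\frac{k-1}{2}\rfloor}F_{\lfloor\frac n2\rfloor-i-1}\!\left(\left\lfloor\tfrac x2\right\rfloor-i,k\right) & \text{if } k+n \text{ is odd},\end{cases}$$ where an empty sum (upper limit smaller than the lower limit) equals $0$.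
   Context: For integers $m\ge 0$ and $y,j\ge 0$, $B_m^{y,j}$ denotes the set of binary strings of length $m$ that contain exactly $y$ zeros and in which the longest block of consecutive zeros has length exactly $j$ (the all-ones string, including the empty string, lies in $B_m^{0,0}$); $F_m(y,j)=|B_m^{y,j}|$, which is $0$ when no such string exists, and $F_m(y,j)=0$ for $m<0$. $\hat B_n^{x,k}$ denotes the set of palindromic binary strings (equal to their reversal) of length $n$ with exactly $x$ zeros and longest block of consecutive zeros of length exactly $k$, and $\hat F_n(x,k)=|\hat B_n^{x,k}|$. *)

(* Defs.v *)
From mathcomp Require Import all_boot all_order all_algebra.

Set Implicit Arguments.
Unset Strict Implicit.
Unset Printing Implicit Defensive.

(* Binary strings are boolean sequences: false is the letter 0, true is 1. *)
Definition zeros (s : seq bool) : nat := count_mem false s.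

Definition longest_zero_block (s : seq bool) : nat :=
  \max_(l < (size s).+1 | infix (nseq l false) s) l.

Definition B (m : nat) (y j : int) : {set m.-tuple bool} :=
  [set s : m.-tuple bool | (Posz (zeros s) == y) && (Posz (longest_zero_block s) == j)].

Definition F (m y j : int) : nat :=
  if m is Posz m' then #|B m' y j| else 0.

Definition Bhat (n : nat) (x k : int) : {set n.-tuple bool} :=
  [set s : n.-tuple bool in B n x k | rev s == s :> seq bool].

Definition Fhat (n x k : int) : nat :=
  if n is Posz n' then #|Bhat n' x k| else 0.

(* The sum of f i for 0 <= i <= b; it is empty when b < 0. *)
Definition sum_upto (b : int) (f : int -> nat) : nat :=
  if b is Posz b' then \sum_(i < b'.+1) f (Posz i) else 0.

Arguments F (m y j)%_ring_scope.
Arguments sum_upto b%_ring_scope f%_function_scope.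

(* Main.v *)
Require Import Defs.
From mathcomp Require Import all_boot all_order all_algebra.
From mathcomp Require Import zify.
Local Open Scope ring_scope.

(** Since [x] and [n] have the same parity, a palindrome with [x] zeros and at
    least one 1 is uniquely [w 1 0^c 1 rev(w)] with [c] congruent to [n] mod 2.
    Its longest zero block is the larger of [c] and that of [w], so it is
    [k] iff either [c < k] and [w] has longest block [k] (first sum), or [c = k]
    and [w] has longest block at most [k] (second sum). *)

Section NatCounting.
Local Open Scope nat_scope.

(** * Zero blocks and zero counts under concatenation and reversal *)

Lemma prefix_nseq_cat_true l (w v : seq bool) :
  prefix (nseq l false) (w ++ true :: v) = prefix (nseq l false) w.
Proof. by elim: w l => [|b w IHw] [|l] //=; rewrite IHw. Qed.

(** A run of zeros cannot cross a 1, so it lies wholly on one side of it. *)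
Lemma infix_nseq_cat_true l (w v : seq bool) :
  infix (nseq l false) (w ++ true :: v)
  = infix (nseq l false) w || infix (nseq l false) v.
Proof.
elim: w => [|b w IHw]; first by case: l => [|l] //=; case: v.
by rewrite cat_cons !infix_consl -cat_cons prefix_nseq_cat_true IHw orbA.
Qed.

(** Every shorter run of zeros sits inside a longest one. This trades the maximum for infix
    tests. *)
Lemma leq_longest_zero_block l s :
  (l <= longest_zero_block s) = infix (nseq l false) s.
Proof.
apply/idP/idP => [|inf_l].
  rewrite /longest_zero_block.
  have [i inf_i ->] : {i : 'I_(size s).+1 | infix (nseq i false) s
      & \max_(l < (size s).+1 | infix (nseq l false) s) l = i}.
    (* The empty run always occurs, so the maximum is attained. *)
    by apply: eq_bigmax_cond; apply/card_gt0P; exists ord0; exact: infix0s.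
  move=> le_li; apply: infix_trans inf_i.
  by rewrite -(subnKC le_li) nseqD prefix_infix.
have lt_l : l < (size s).+1 by rewrite ltnS -(size_nseq l false) size_infix.
exact: (@leq_bigmax_cond _ _ (fun i : 'I__ => i : nat) (Ordinal lt_l)).
Qed.

Lemma eq_from_leq m n : (forall l, (l <= m) = (l <= n)) -> m = n.
Proof. by move=> E; apply/eqP; rewrite eqn_leq -E leqnn E leqnn. Qed.

Lemma longest_zero_block_cat_true w v :
  longest_zero_block (w ++ true :: v)
  = maxn (longest_zero_block w) (longest_zero_block v).
Proof.
apply: eq_from_leq => l.
by rewrite leq_max !leq_longest_zero_block infix_nseq_cat_true.
Qed.

Lemma longest_zero_block_nseq c : longest_zero_block (nseq c false) = c.
Proof.
apply/eqP; rewrite eqn_leq leq_longest_zero_block infix_refl andbT.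
have : infix (nseq (longest_zero_block (nseq c false)) false) (nseq c false).
  by rewrite -leq_longest_zero_block.
by move/size_infix; rewrite !size_nseq.
Qed.

Lemma longest_zero_block_rev s :
  longest_zero_block (rev s) = longest_zero_block s.
Proof.
apply: eq_from_leq => l.
by rewrite !leq_longest_zero_block -infix_rev revK rev_nseq.
Qed.

Lemma zeros_cat s t : zeros (s ++ t) = zeros s + zeros t.
Proof. exact: count_cat. Qed.

Lemma zeros_cat_true w v : zeros (w ++ true :: v) = zeros w + zeros v.
Proof. exact: zeros_cat. Qed.

Lemma zeros_rev s : zeros (rev s) = zeros s.
Proof. exact: count_rev. Qed.

Lemma zeros_nseq c : zeros (nseq c false) = c.
Proof. by rewrite /zeros count_nseq mul1n. Qed.

(** * Counting strings of a given length by their last letters *)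

Definition strings_count m (P : pred (seq bool)) : nat :=
  #|[set t : m.-tuple bool | P t]|.

Lemma eq_strings_count m P Q : P =1 Q -> strings_count m P = strings_count m Q.
Proof. by move=> E; apply: eq_card => t; rewrite !inE E. Qed.

Lemma strings_count_sum m P : strings_count m P = \sum_(t : m.-tuple bool) P t.
Proof. by rewrite /strings_count -sum1dep_card big_mkcond. Qed.

Lemma strings_count_rcons m P :
  strings_count m.+1 P
  = strings_count m (fun w => P (rcons w true))
    + strings_count m (fun w => P (rcons w false)).
Proof.
pose f (p : m.-tuple bool * bool) := [tuple of rcons p.1 p.2].
pose g (t : m.+1.-tuple bool) :=
  ([tuple of belast (thead t) (behead t)], last (thead t) (behead t)).
have gK : cancel g f.
  move=> t; apply: val_inj; rewrite /= -lastI.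
  by rewrite [in RHS](tuple_eta t).
have fK : cancel f g.
  (* By [gK], [p] and [g (f p)] have the same image under [f]; [rcons] is injective. *)
  move=> p; have := gK (f p); rewrite {1}/f.
  move=> /(congr1 val)/= /rcons_inj[e1 e2].
  by rewrite [p]surjective_pairing; congr pair; [apply: val_inj|].
rewrite !strings_count_sum (reindex f) /=; last first.
  by exists g => t _; [apply: fK|apply: gK].
rewrite -(pair_bigA _ (fun (t : m.-tuple bool) b => P (rcons t b) : nat)) /=.
by rewrite -big_split; apply: eq_bigr => t _; rewrite big_bool.
Qed.

(* Classifies strings by their number of trailing zeros. *)
Lemma strings_count_last_true h P :
  strings_count h P
  = \sum_(i < h) strings_count (h - i - 1)
                   (fun w => P (w ++ true :: nseq i false))
    + P (nseq h false).
Proof.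
elim: h P => [|h IHh] P.
  rewrite big_ord0 strings_count_sum (bigD1 [tuple]) //= big1 ?addn0 //.
  by move=> t /negP[]; rewrite (tuple0 t).
(* Strings ending in 1 give the term [i = 0]; stripping the last 0 from the others shifts the index
   by one. *)
rewrite strings_count_rcons (IHh (fun w => P (rcons w false))).
rewrite big_ord_recl -!addnA.
congr (_ + _).
  by rewrite subn0 subn1; apply: eq_strings_count => w; rewrite cats1.
have rcons_nseq j : rcons (nseq j false) false = nseq j.+1 false.
  by rewrite -cats1 -(nseqD j 1) addn1.
congr (_ + _); last by rewrite rcons_nseq.
apply: eq_bigr => i _; rewrite lift0 subSS.
by apply: eq_strings_count => w; rewrite rcons_cat /= rcons_nseq.
Qed.

(** * Palindromes and their left halves *)

Lemma palindrome_split h e s :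
    e <= 1 -> size s = h + (e + h) -> rev s = s -> odd (zeros s) = odd e ->
  s = take h s ++ nseq e false ++ rev (take h s).
Proof.
move=> le_e1 sz_s.
have sz_a : size (take h s) = h by rewrite size_takel ?sz_s ?leq_addr.
have sz_m : size (take e (drop h s)) = e.
  by rewrite size_takel // size_drop sz_s addKn leq_addr.
have sz_b : size (drop e (drop h s)) = h by rewrite !size_drop sz_s !addKn.
have def_s : s = take h s ++ take e (drop h s) ++ drop e (drop h s).
  by rewrite !cat_take_drop.
move: (take h s) (take e _) (drop e _) sz_a sz_m sz_b def_s.
move=> a m b sz_a sz_m sz_b.
move=> -> /eqP; rewrite !rev_cat -catA eqseq_cat ?size_rev ?sz_a //.
case/andP=> /eqP <- _; rewrite !zeros_cat zeros_rev revK => odd_s.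
congr (_ ++ (_ ++ _)); move: m sz_m odd_s.
(* The two halves contribute an even number of zeros, so for [e = 1] parity forces the middle letter
   to be 0. *)
case: e le_e1 {sz_s} => [_ [] //|[|//] _].
case=> // c [] //= _; rewrite addnCA addnn oddD odd_double addbF.
by case: c.
Qed.

(** Mirroring the left half around the middle, which parity fixes, is a bijection onto the
    palindromes satisfying [Q]. *)
Lemma palindrome_count h e (Q : pred (seq bool)) : e <= 1 ->
    (forall s, Q s -> odd (zeros s) = odd e) ->
  strings_count (h + (e + h)) (fun s => Q s && (rev s == s))
  = strings_count h (fun u => Q (u ++ nseq e false ++ rev u)).
Proof.
move=> le_e1 oddQ.
pose f (u : h.-tuple bool) : (h + (e + h)).-tuple bool :=
  [tuple of u ++ nseq e false ++ rev u].
have f_inj : injective f.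
  move=> u v /(congr1 val)/= /eqP; rewrite eqseq_cat ?size_tuple //.
  by case/andP=> /eqP uv _; apply: val_inj.
rewrite /strings_count -(card_imset _ f_inj); apply: eq_card => s.
rewrite inE; apply/idP/imsetP => [/andP[Qs /eqP pal_s]|[u]]; last first.
  by rewrite inE => Qu ->; rewrite Qu /= !rev_cat revK rev_nseq catA eqxx.
have sz_a : size (take h s) == h by rewrite size_takel ?size_tuple ?leq_addr.
have def_s := palindrome_split h e s le_e1 (size_tuple s) pal_s (oddQ s Qs).
by exists (Tuple sz_a); [rewrite inE -def_s | apply: val_inj].
Qed.

Definition block_strings m y j :=
  strings_count m (fun w => (zeros w == y) && (longest_zero_block w == j)).

(* [w] is the part of the palindrome to the left of the 1 bordering the middle
   block of [i + e + i] zeros. *)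
Lemma palindrome_count_middle h e y k : e <= 1 -> y < h ->
  strings_count (h + (e + h))
    (fun s => ((zeros s == y.*2 + e) && (longest_zero_block s == k))
              && (rev s == s))
  = \sum_(i < h) strings_count (h - i - 1)
      (fun w => (zeros w + i == y)
                && (maxn (longest_zero_block w) (i.*2 + e) == k)).
Proof.
move=> le_e1 lt_yh; rewrite palindrome_count //; last first.
  by move=> s /andP[/eqP-> _]; rewrite oddD odd_double.
rewrite strings_count_last_true rev_nseq !zeros_cat !zeros_nseq.
(* The all-zero half is excluded: as [y < h], it yields too many zeros. *)
have /negPf-> : h + (e + h) != y.*2 + e by lia.
rewrite addn0; apply: eq_bigr => i _; apply: eq_strings_count => w.
rewrite rev_cat rev_cons rev_nseq cat_rcons -catA cat_cons.
rewrite [nseq e _ ++ _]catA [nseq i _ ++ _ ++ _]catA -!nseqD.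
rewrite !longest_zero_block_cat_true.
rewrite longest_zero_block_nseq longest_zero_block_rev.
rewrite !zeros_cat_true zeros_nseq zeros_rev.
congr (_ && _); first by lia.
by congr (_ == _); lia.
Qed.

(** Serves the case of a middle block of length exactly [k], where the left part is only bounded. *)
Lemma strings_count_longest_leq m y k :
  strings_count m (fun w => (zeros w == y) && (longest_zero_block w <= k))
  = \sum_(j < k.+1) block_strings m y j.
Proof.
rewrite strings_count_sum.
under [RHS]eq_bigr do rewrite /block_strings strings_count_sum.
rewrite exchange_big; apply: eq_bigr => w _ /=.
case: (zeros w == y); last by rewrite big1.
case: leqP => [le_wk|lt_kw].
  rewrite (bigD1 (Ordinal (le_wk : _ < k.+1))) //= eqxx big1 // => j /negPf.
  by rewrite eq_sym -val_eqE /= => ->.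
by rewrite big1 // => j _; have := ltn_ord j; case: eqP => //; lia.
Qed.

Lemma palindrome_count_sum h e y k : e <= 1 -> y < h -> k <= y ->
  strings_count (h + (e + h))
    (fun s => ((zeros s == y.*2 + e) && (longest_zero_block s == k))
              && (rev s == s))
  = \sum_(i < uphalf (k - e)) block_strings (h - i - 1) (y - i) k
    + (if (e <= k) && ~~ odd (k + e) then
         \sum_(j < k.+1) block_strings (h - (k - e)./2 - 1) (y - (k - e)./2) j
       else 0).
Proof.
move=> le_e1 lt_yh le_ky; rewrite palindrome_count_middle //.
pose G i := strings_count (h - i - 1)
  (fun w => (zeros w + i == y)
            && (maxn (longest_zero_block w) (i.*2 + e) == k)).
(* [b] is the least [i] with [k <= i.*2 + e]: below it the middle block is shorter than [k]. *)
set b := uphalf _; have le_bh : b < h by rewrite /b; lia.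
have -> : \sum_(i < h) G i = \sum_(i < b) G i + \sum_(b <= i < h) G i.
  by rewrite -2!(big_mkord xpredT G) -big_cat_nat // ltnW.
(* The subtraction [y - i] is truncated, hence the restriction to [i <= y]. *)
have GE i : i <= y -> G i = strings_count (h - i - 1)
    (fun w => (zeros w == y - i)
              && (maxn (longest_zero_block w) (i.*2 + e) == k)).
  by move=> le_iy; apply: eq_strings_count => w; congr (_ && _); lia.
congr (_ + _).
  apply: eq_bigr => i _; have lt_ib := ltn_ord i.
  rewrite GE; last by move: lt_ib; rewrite /b; lia.
  apply: eq_strings_count => w; congr (_ && _).
  by move: lt_ib; rewrite /b; lia.
have G0 i : k < i.*2 + e -> G i = 0.
  move=> lt_ki; apply/eqP; rewrite cards_eq0; apply/eqP/setP=> w.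
  by rewrite !inE; apply/negbTE; lia.
(* A middle block of length exactly [k] needs [k - e] even and nonnegative, and then [i = b]; all
   other [i >= b] exceed [k]. *)
case: ifP => [/andP[le_ek ev_k]|not_ek]; last first.
  rewrite big_nat big1 // => i /andP[le_bi _]; apply: G0.
  by move: le_bi not_ek; rewrite /b; lia.
have -> : (k - e)./2 = b by rewrite /b; lia.
rewrite big_ltn // big_nat big1 ?addn0 => [|i /andP[lt_bi _]]; last first.
  by apply: G0; move: lt_bi; rewrite /b; lia.
rewrite GE; last by rewrite /b; lia.
rewrite -strings_count_longest_leq; apply: eq_strings_count => w.
by congr (_ && _); rewrite /b; lia.
Qed.

End NatCounting.

(** * Transfer to integer arguments *)

Lemma F_nat (m y j : int) (m' y' j' : nat) :
  m = m' -> y = y' -> j = j' -> F m y j = block_strings m' y' j'.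
Proof. by move=> -> -> ->; apply: eq_card => t; rewrite !inE !eqz_nat. Qed.

Lemma sum_upto_nat (b : int) f (m : nat) :
  b = m%:Z - 1 -> sum_upto b f = (\sum_(i < m) f (Posz i))%N.
Proof.
move=> ->; case: m => [|m]; first by rewrite big_ord0.
by rewrite -[m.+1]addn1 PoszD GRing.addrK addn1.
Qed.

Theorem theorem5p5 (n x k : int)
    (hn : 4 <= n)
    (hx : 2 <= x <= n - 2)
    (hxn : (x = n %[mod 2])%Z)
    (hk : (n %/ (n - x + 1))%Z <= k <= (x %/ 2)%Z) :
  Fhat n x k =
    if (2 %| k + n)%Z then
      (sum_upto ((k - 2) %/ 2)%Z
         (fun i => F ((n %/ 2)%Z - i - 1) ((x %/ 2)%Z - i) k)
       + sum_upto k
         (fun j => F (((n - k) %/ 2)%Z - 1) ((x - k) %/ 2)%Z j))%N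
    else
      sum_upto ((k - 1) %/ 2)%Z
        (fun i => F ((n %/ 2)%Z - i - 1) ((x %/ 2)%Z - i) k).
Proof.
(* From [x >= 2], the divisor [n - x + 1] is at most [n]. Positivity of [k] later gives [e <= k'],
   leaving a split by parity alone. *)
have k_gt0 : 1 <= k.
  case/andP: hk => hk _; apply: Order.POrderTheory.le_trans hk.
  by rewrite lez_divRL ?mul1r; lia.
case/andP: hk => _ hk.
(* Equal parity gives [n] and [x] the same remainder [e]; [x <= n - 2] becomes [y < h]. *)
pose h := `|(n %/ 2)%Z|%N; pose e := `|(n %% 2)%Z|%N; pose y := `|(x %/ 2)%Z|%N.
have [k' def_k] : exists k' : nat, k = k' by exists `|k|%N; lia.
have le_e1 : (e <= 1)%N by rewrite /e; lia.
have def_n : n = (h + (e + h))%N by rewrite /h /e; lia.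
have def_x : x = (y.*2 + e)%N by rewrite /y /e; lia.
move: h e y le_e1 def_n def_x => h e y le_e1 def_n def_x; subst n x k.
have lt_yh : (y < h)%N by lia.
have le_ky : (k' <= y)%N by lia.
transitivity (strings_count (h + (e + h))
    (fun s => ((zeros s == y.*2 + e) && (longest_zero_block s == k'))
              && (rev s == s)))%N.
  by apply: eq_card => t; rewrite !inE !eqz_nat.
rewrite palindrome_count_sum //.
(* The bound [b] stays general because both upper limits, the floors of [(k - 2) / 2] for [k + n]
   even and [(k - 1) / 2] for [k + n] odd, have this value. *)
have firstE b : b = (uphalf (k' - e))%:Z - 1 ->
    sum_upto b (fun i => F (((h + (e + h))%N %/ 2)%Z - i - 1)
                           (((y.*2 + e)%N %/ 2)%Z - i) k')
    = (\sum_(i < uphalf (k' - e)) block_strings (h - i - 1) (y - i) k')%N.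
  move=> def_b; rewrite (sum_upto_nat _ _ _ def_b); apply: eq_bigr => i _.
  by have lt_i := ltn_ord i; apply: F_nat; lia.
case: ifP => [/andP[le_ek ev_k]|not_ek]; last first.
  by rewrite ifF ?addn0 ?firstE; lia.
rewrite ifT; last by lia.
rewrite firstE; last by lia.
rewrite (sum_upto_nat _ _ k'.+1); last by lia.
by congr (_ + _)%N; apply: eq_bigr => j _; apply/esym/F_nat; lia.
Qed.
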